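(* Let $X$ be a finite graded poset with minimum and maximum and let $f,g\in F(X)$. The pair $(f,g)$ is symmetric if and only if there exists an involution $\iota:X\to X$ such that $f=g\circ\iota$.
   Context: $F(X)$ is the ring of functions $X\to\mathbb{Z}$. A pair $(f,g)\in F(X)\times F(X)$ is symmetric if $\sum_{x\in X}q^{f(x)}t^{g(x)}=\sum_{x\in X}q^{g(x)}t^{f(x)}$ in the semiring of Laurent polynomials $\mathbb{N}[q,t,q^{-1},t^{-1}]$. An involution is a map of sets $\iota$ with $\iota\circ\iota=\mathrm{id}$ (no compatibility with the order is required). *)

(* Defs.v *)
From HB Require Import structures.
From mathcomp Require Import all_boot all_order all_algebra finmap.

Set Implicit Arguments.
Unset Strict Implicit.
Unset Printing Implicit Defensive.

Import Order.TTheory GRing.Theory Num.Theory.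

Local Open Scope ring_scope.

(* A maximal chain is an inclusion-maximal totally ordered subset; having equal
   cardinalities is the same as having equal lengths (cardinality minus one). *)
Section Graded.
Context {d : Order.disp_t} (X : finPOrderType d).

Definition chain (C : {set X}) : bool :=
  [forall x in C, forall y in C, (x >=< y)%O].

Definition maximal_chain (C : {set X}) : bool := maxset chain C.

Definition graded : Prop :=
  forall C D : {set X}, maximal_chain C -> maximal_chain D -> #|C| = #|D|.

End Graded.

(* The semiring N[q, t, q^-1, t^-1] is the monoid semiring of Z x Z over N: a
   Laurent polynomial is the finitely supported family of its coefficients,
   indexed by the pairs (exponent of q, exponent of t). The library's monoid
   algebras require coefficients in a ring and monoids without nontrivial units,
   hence the direct construction. *)
Record laurent : predArgType :=
  Laurent { laurent_fsfun : {fsfun int * int -> nat with 0%N} }.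

HB.instance Definition _ := [isNew for laurent_fsfun].
HB.instance Definition _ := [Choice of laurent by <:].

Definition lcoef (p : laurent) (k : int * int) : nat := laurent_fsfun p k.

Definition lsupp (p : laurent) : {fset int * int} := finsupp (laurent_fsfun p).

Lemma laurentP (p r : laurent) : (forall k, lcoef p k = lcoef r k) <-> p = r.
Proof. by case: p r => [p] [r]; split=> [h | -> //]; congr Laurent; apply/fsfunP. Qed.

Lemma lcoef_out p k : k \notin lsupp p -> lcoef p k = 0%N.
Proof. exact: fsfun_dflt. Qed.

Definition lzero : laurent := Laurent [fsfun].

Definition lmono (k : int * int) : laurent :=
  Laurent [fsfun x in [fset k]%fset => 1%N].

Definition ladd (p r : laurent) : laurent :=
  Laurent [fsfun k in (lsupp p `|` lsupp r)%fset => (lcoef p k + lcoef r k)%N].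

Definition lmul (p r : laurent) : laurent :=
  Laurent [fsfun k in [fset (i + j)%R | i in lsupp p, j in lsupp r]%fset =>
     (\sum_(i <- lsupp p) lcoef p i * lcoef r (k - i)%R)%N].

Lemma lcoef0 k : lcoef lzero k = 0%N.
Proof. by rewrite /lcoef /laurent_fsfun fsfun0E. Qed.

Lemma lcoef_mono k l : lcoef (lmono k) l = (l == k).
Proof. by rewrite /lcoef /laurent_fsfun fsfun_fun inE; case: eqP. Qed.

Lemma lcoefD p r k : lcoef (ladd p r) k = (lcoef p k + lcoef r k)%N.
Proof.
rewrite {1}/lcoef /laurent_fsfun fsfun_fun in_fsetU.
by case: ifPn => //; rewrite negb_or => /andP[/lcoef_out-> /lcoef_out->].
Qed.

Lemma lcoefMw (D : {fset int * int}) p r k : (lsupp p `<=` D)%fset ->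
  lcoef (lmul p r) k = (\sum_(i <- D) lcoef p i * lcoef r (k - i)%R)%N.
Proof.
move=> sub; rewrite {1}/lcoef /laurent_fsfun fsfun_fun.
transitivity (\sum_(i <- lsupp p) lcoef p i * lcoef r (k - i)%R)%N; last first.
  by apply: big_fset_incl => // i _ /lcoef_out->.
case: ifPn => // nk; rewrite big1_seq // => i /andP[_ ip].
have [jr|/lcoef_out->] := boolP (k - i \in lsupp r); last by rewrite muln0.
case/negP: nk; apply/imfset2P; exists i => //; exists (k - i) => //.
by rewrite addrC subrK.
Qed.

Lemma lcoefM p r k :
  lcoef (lmul p r) k = (\sum_(i <- lsupp p) lcoef p i * lcoef r (k - i)%R)%N.
Proof. exact: lcoefMw. Qed.

Lemma laddA : associative ladd.
Proof. by move=> p r s; apply/laurentP => k; rewrite !lcoefD addnA. Qed.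

Lemma laddC : commutative ladd.
Proof. by move=> p r; apply/laurentP => k; rewrite !lcoefD addnC. Qed.

Lemma ladd0 : left_id lzero ladd.
Proof. by move=> p; apply/laurentP => k; rewrite lcoefD lcoef0. Qed.

Lemma sum_imfset (h : int * int -> int * int) (D : {fset int * int})
    (F : int * int -> nat) : injective h ->
  (\sum_(i <- [fset h i | i in D]%fset) F i = \sum_(i <- D) F (h i))%N.
Proof. by move=> h_inj; rewrite big_imfset //= => i j _ _; exact: h_inj. Qed.

Lemma lmulC : commutative lmul.
Proof.
move=> p r; apply/laurentP => k.
pose D := (lsupp p `|` [fset (k - j)%R | j in lsupp r])%fset.
pose E := [fset (k - i)%R | i in D]%fset.
have subE : (lsupp r `<=` E)%fset.
  apply/fsubsetP => j jr; apply/imfsetP; exists (k - j); last by rewrite subKr.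
  by rewrite /= in_fsetU; apply/orP; right; apply/imfsetP; exists j.
rewrite (@lcoefMw D) ?fsubsetUl // (lcoefMw _ _ subE) sum_imfset.
  by apply: eq_bigr => i _; rewrite subKr mulnC.
by move=> i j /addrI/oppr_inj.
Qed.

Lemma lmulA : associative lmul.
Proof.
move=> p r s; apply/laurentP => k; rewrite lcoefM.
pose D := [fset (i + j)%R | i in lsupp p, j in lsupp r]%fset.
have subD : (lsupp (lmul p r) `<=` D)%fset.
  apply/fsubsetP => i; apply: contraTT => iD.
  by rewrite memNfinsupp fsfun_fun (negPf iD).
rewrite (lcoefMw _ _ subD).
under [RHS]eq_bigr do rewrite lcoefM big_distrl /=.
rewrite exchange_big /=; apply: eq_big_seq => i ip.
pose E := [fset (l - i)%R | l in D]%fset.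
have subE : (lsupp r `<=` E)%fset.
  apply/fsubsetP => j jr; apply/imfsetP; exists (i + j); last by rewrite addrC addKr.
  by apply/imfset2P; exists i => //; exists j.
rewrite (lcoefMw _ _ subE) sum_imfset; last by move=> a b /addIr.
rewrite big_distrr /=; apply: eq_bigr => l _.
by rewrite mulnA opprB addrA subrK.
Qed.

Lemma lcoef_monoM a p k : lcoef (lmul (lmono a) p) k = lcoef p (k - a).
Proof.
rewrite (@lcoefMw [fset a]%fset) ?big_seq_fset1 ?lcoef_mono ?eqxx ?mul1n //.
apply/fsubsetP => i; apply: contraTT => ia.
by rewrite memNfinsupp fsfun_fun (negPf ia).
Qed.

Lemma lmul1 : left_id (lmono 0) lmul.
Proof. by move=> p; apply/laurentP => k; rewrite lcoef_monoM subr0. Qed.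

Lemma lmulDl : left_distributive lmul ladd.
Proof.
move=> p r s; apply/laurentP => k.
pose D := (lsupp (ladd p r) `|` (lsupp p `|` lsupp r))%fset.
rewrite lcoefD !(@lcoefMw D) /D ?fsubsetUl //.
- by rewrite -big_split; apply: eq_bigr => i _; rewrite lcoefD mulnDl.
- by rewrite fsetUCA fsetUA fsubsetUr.
- by rewrite fsetUCA fsubsetUl.
Qed.

Lemma lmul0 : left_zero lzero lmul.
Proof.
by move=> p; apply/laurentP => k; rewrite lcoefM lcoef0 big1 // => i _; rewrite lcoef0.
Qed.

Lemma l1_neq0 : lmono 0 != lzero.
Proof.
by apply/eqP => /laurentP/(_ 0); rewrite lcoef_mono lcoef0 eqxx.
Qed.

HB.instance Definition _ := GRing.isNmodule.Build laurent laddA laddC ladd0.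
HB.instance Definition _ := GRing.Nmodule_isComNzSemiRing.Build laurent
  lmulA lmulC lmul1 lmulDl lmul0 l1_neq0.

Definition qvar : laurent := lmono (1, 0).
Definition qvarV : laurent := lmono (-1, 0).
Definition tvar : laurent := lmono (0, 1).
Definition tvarV : laurent := lmono (0, -1).

(* The power u^a with integer exponent a of an element u with inverse v; the
   library's integer powers are not available in a semiring. *)
Definition lpow (u v : laurent) (a : int) : laurent :=
  match a with Posz n => u ^+ n | Negz n => v ^+ n.+1 end.

Definition qpow (a : int) : laurent := lpow qvar qvarV a.
Definition tpow (a : int) : laurent := lpow tvar tvarV a.

Lemma lmonoM a b : lmono a * lmono b = lmono (a + b).
Proof.
apply/laurentP => k; rewrite lcoef_monoM !lcoef_mono.
by rewrite subr_eq addrC.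
Qed.

Lemma lmonoX a n : lmono a ^+ n = lmono (a *+ n).
Proof. by elim: n => // n IHn; rewrite exprS mulrS IHn lmonoM. Qed.

Lemma qvarVK : qvar * qvarV = 1.
Proof. by rewrite lmonoM. Qed.

Lemma tvarVK : tvar * tvarV = 1.
Proof. by rewrite lmonoM. Qed.

Lemma qpowE a : qpow a = lmono (a, 0).
Proof.
have H (x : int) n : (x, 0 : int) *+ n = (x *+ n, 0).
  by elim: n => // n IHn; rewrite !mulrS IHn.
case: a => n; rewrite /qpow /lpow lmonoX H; congr (lmono (_, _)).
  by rewrite natz.
by rewrite mulNrn natz.
Qed.

Lemma tpowE a : tpow a = lmono (0, a).
Proof.
have H (x : int) n : (0 : int, x) *+ n = (0, x *+ n).
  by elim: n => // n IHn; rewrite !mulrS IHn.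
case: a => n; rewrite /tpow /lpow lmonoX H; congr (lmono (_, _)).
  by rewrite natz.
by rewrite mulNrn natz.
Qed.

Lemma qtpowE a b : qpow a * tpow b = lmono (a, b).
Proof.
by rewrite qpowE tpowE lmonoM; congr lmono; apply/eqP; rewrite xpair_eqE addr0 add0r !eqxx.
Qed.

Definition symmetric_pair (X : finType) (f g : {ffun X -> int}) : Prop :=
  \sum_(x : X) qpow (f x) * tpow (g x) = \sum_(x : X) qpow (g x) * tpow (f x).

(* Main.v *)
Require Import Defs.
From mathcomp Require Import all_boot all_order all_algebra.

(** The coefficient of [q^a t^b] in the sum attached to [(f, g)] is the number
    of points where [f] takes the value [a] and [g] the value [b]. So the pair is
    symmetric exactly when the fibres of [x |-> (f x, g x)] over [(a, b)] and
    over [(b, a)] always have the same cardinality ([symmetric_pair_card]).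

    In that case, list every fibre in the order of a fixed enumeration of [X],
    and send the [i]-th point of the fibre over [(a, b)] to the [i]-th point of
    the fibre over [(b, a)]. This map exchanges the two fibres, hence the values
    of [f] and [g], and it undoes itself ([fibre_swapK]); on a diagonal fibre it
    is the identity.

    Conversely, an involution [iota] with [f = g \o iota] also satisfies
    [g = f \o iota], so reindexing the sum along [iota] exchanges [f] and [g]. *)

Set Implicit Arguments.
Unset Strict Implicit.
Unset Printing Implicit Defensive.

Section FibreSwap.
Variables (X : finType) (T : eqType) (f g : X -> T).

Definition fibre (a b : T) : pred X := [pred x | (f x == a) && (g x == b)].

Lemma mem_fibre x : x \in fibre (f x) (g x).
Proof. by rewrite inE !eqxx. Qed.

(** The default value [x] of [nth] is reached only if the opposite fibre is
   smaller than the fibre of [x]. *)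
Definition fibre_swap (x : X) : X :=
  nth x (enum (fibre (g x) (f x))) (index x (enum (fibre (f x) (g x)))).

Hypothesis card_fibreC : forall a b, #|fibre a b| = #|fibre b a|.

Lemma index_fibre_lt x :
  index x (enum (fibre (f x) (g x))) < size (enum (fibre (g x) (f x))).
Proof. by rewrite -cardE -card_fibreC cardE index_mem mem_enum mem_fibre. Qed.

Lemma fibre_swapE x : f (fibre_swap x) = g x /\ g (fibre_swap x) = f x.
Proof.
have := mem_nth x (index_fibre_lt x).
by rewrite -/(fibre_swap x) mem_enum inE => /andP[/eqP-> /eqP->].
Qed.

(** The image of [x] has in its own fibre the rank that [x] has in the fibre of
    [x], so the second application reads off the point of that rank, [x]. *)
Lemma fibre_swapK : involutive fibre_swap.
Proof.
move=> x; have [fE gE] := fibre_swapE x.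
rewrite {1}/fibre_swap fE gE.
rewrite {2}/fibre_swap index_uniq ?index_fibre_lt ?enum_uniq //.
by rewrite nth_index // mem_enum mem_fibre.
Qed.

End FibreSwap.

Lemma lcoef_sum_qt (X : finType) (f g : X -> int) (a b : int) :
  lcoef (\sum_(x : X) qpow (f x) * tpow (g x))%R (a, b) = #|fibre f g a b|.
Proof.
rewrite (big_morph (lcoef^~ (a, b)) (fun p r => lcoefD p r (a, b)) (lcoef0 _)).
rewrite -sum1_card [RHS]big_mkcond /=; apply: eq_bigr => x _.
rewrite qtpowE lcoef_mono xpair_eqE inE (eq_sym a) (eq_sym b).
by case: (_ && _).
Qed.

Lemma symmetric_pair_card (X : finType) (f g : {ffun X -> int}) :
  symmetric_pair f g <-> forall a b, #|fibre f g a b| = #|fibre f g b a|.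
Proof.
have fibreC a b : #|fibre f g b a| = #|fibre g f a b|.
  by apply: eq_card => x; rewrite !inE andbC.
split=> [sym a b | card_eq].
  by rewrite fibreC -!lcoef_sum_qt; congr (lcoef _ _).
by apply/laurentP => -[a b]; rewrite !lcoef_sum_qt card_eq fibreC.
Qed.

Theorem theorem3p14 (d : Order.disp_t) (X : finTBPOrderType d)
    (f g : {ffun X -> int}) :
  graded X ->
  (symmetric_pair f g <->
   exists iota : X -> X, involutive iota /\ f = [ffun x => g (iota x)]).
Proof.
move=> _; split=> [/symmetric_pair_card card_eq | [iota [iotaK ->]]].
  exists (fibre_swap f g); split; first exact: fibre_swapK.
  by apply/ffunP => x; rewrite ffunE; have [_ ->] := fibre_swapE card_eq x.
rewrite /symmetric_pair (reindex_inj (inv_inj iotaK)) /=.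
by apply: eq_bigr => x _; rewrite !ffunE iotaK.
Qed.
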